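(* Let $q$ be a fixed prime power. Then, as $n\to\infty$, $B_q(n,2,2;3)=o(q^{2n})$.
   Context: For a prime power $q$, $\mathcal{G}_q(n,k)$ denotes the set of all $k$-dimensional subspaces of $\mathbb{F}_q^n$. An $\alpha$-$(n,k,\delta)_q^c$ covering Grassmannian code is a subset $\mathcal{C}\subseteq\mathcal{G}_q(n,k)$ (no repeated codewords) such that every set of $\alpha$ distinct codewords of $\mathcal{C}$ spans a subspace of $\mathbb{F}_q^n$ of dimension at least $k+\delta$. $B_q(n,k,\delta;\alpha)$ denotes the maximum size of an $\alpha$-$(n,k,\delta)_q^c$ code. *)

(* Defs.v *)
From HB Require Import structures.
From mathcomp Require Import all_boot all_order all_algebra all_field.
Set Implicit Arguments. Unset Strict Implicit. Unset Printing Implicit Defensive.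
Import Order.TTheory GRing.Theory Num.Theory.

Definition covering_grassmannian_code (F : fieldType) (n k delta alpha : nat)
    (C : seq {vspace 'rV[F]_n}) : Prop :=
  [/\ uniq C,
      (forall U, U \in C -> \dim U = k) &
      (forall S : seq {vspace 'rV[F]_n},
          uniq S -> size S = alpha -> {subset S <= C} ->
          k + delta <= \dim (\sum_(U <- S) U)%VS)].

(* Main.v *)
Require Import Defs.
From HB Require Import structures.
From mathcomp Require Import all_boot all_order all_algebra all_field.
From mathcomp Require Import ring lra.
Import Order.TTheory GRing.Theory Num.Theory.
Set Implicit Arguments. Unset Strict Implicit. Unset Printing Implicit Defensive.
Local Open Scope ring_scope.

(** Join two vectors of [F_q^n] when they span a codeword.  If [x], [y], [z] form
    a triangle, the three codewords they span lie in a common space of dimension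
    at most 3, so they cannot be distinct, and hence [z] lies in the codeword
    spanned by [x] and [y].  Thus every edge is in at most [q^2] triangles, and by
    triangle removal (Ruzsa-Szemeredi) a set of [o(q^(2n))] edges meets all
    triangles.  A codeword with basis [x], [y] contains the triangle
    [x], [y], [x + y], so it is spanned by one of the removed edges.

    Triangle removal rests on a regularity lemma obtained by energy increment,
    the energy of a colouring being the squared [L^2]-norm of the conditional
    expectation of the adjacency function. *)

(** * Conditional expectation and energy of a colouring *)

Section Average.
Variables (R : realFieldType) (T : finType).

Definition avg (J : eqType) (p : T -> J) (f : T -> R) (x : T) : R :=
  (\sum_(y | p y == p x) f y) / #|[pred y | p y == p x]|%:R.

Definition energy (J : eqType) (p : T -> J) (f : T -> R) : R :=
  \sum_x avg p f x ^+ 2.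

Lemma fiber_card_gt0 (J : eqType) (p : T -> J) x :
  0 < #|[pred y | p y == p x]|%:R :> R.
Proof. by rewrite ltr0n; apply/card_gt0P; exists x; rewrite inE. Qed.

Lemma eq_avg (J : eqType) (p : T -> J) f x y :
  p x = p y -> avg p f x = avg p f y.
Proof. by rewrite /avg => ->. Qed.

(** After exchanging the double sum, the term of [y] occurs once for every point of its fibre, which
    cancels the fibre size in the denominator. *)
Lemma sum_mul_avg (J : eqType) (p : T -> J) (f h : T -> R) :
  (forall x y, p x = p y -> h x = h y) ->
  \sum_x h x * avg p f x = \sum_x h x * f x.
Proof.
move=> hp.
transitivity (\sum_x \sum_(y | p y == p x)
    h y * f y / #|[pred z | p z == p y]|%:R).
  apply: eq_bigr => x _; rewrite /avg mulr_suml mulr_sumr.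
  by apply: eq_bigr => y /eqP pyx; rewrite mulrA pyx (hp _ _ pyx).
rewrite (exchange_big_dep xpredT) //=; apply: eq_bigr => y _.
under eq_bigl do rewrite eq_sym.
rewrite sumr_const -[LHS]mulr_natr -mulrA mulVf ?mulr1 //.
exact: lt0r_neq0 (fiber_card_gt0 p y).
Qed.

(** [avg p f] is constant on the fibres of the finer [p'], so it is orthogonal to
    [avg p' f - avg p f]. *)
Lemma energy_pythagoras (J J' : eqType) (p : T -> J) (p' : T -> J') f :
  (forall x y, p' x = p' y -> p x = p y) ->
  \sum_x (avg p' f x - avg p f x) ^+ 2 = energy p' f - energy p f.
Proof.
move=> ref.
have E1 : \sum_x avg p f x * avg p' f x = energy p f.
  rewrite sum_mul_avg => [|x y /ref/(eq_avg f)//].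
  rewrite -(@sum_mul_avg _ p) => [|x y /(eq_avg f)//].
  by apply: eq_bigr => x _; rewrite expr2.
rewrite (eq_bigr (fun x => avg p' f x ^+ 2 + avg p f x ^+ 2
    + (- 2%:R) * (avg p f x * avg p' f x))); last first.
  by move=> x _; ring.
rewrite !big_split /= -mulr_sumr E1 -/(energy p' f) -/(energy p f); ring.
Qed.

Lemma energy_le (J : eqType) (p : T -> J) f :
  (forall x, 0 <= f x <= 1) -> energy p f <= #|T|%:R.
Proof.
move=> f01; rewrite -sum1_card natr_sum; apply: ler_sum => x _.
have n0 := fiber_card_gt0 p x.
have a0 : 0 <= avg p f x.
  by apply: divr_ge0; rewrite ?(ltW n0) // sumr_ge0 // => y; case/andP: (f01 y).
have a1 : avg p f x <= 1.
  rewrite ler_pdivrMr // mul1r -sum1_card natr_sum.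
  by apply: ler_sum => y; case/andP: (f01 y).
by rewrite expr_le1.
Qed.

End Average.

(* Cauchy-Schwarz, summing [0 <= (h x + t)^2]. *)
Lemma sum_sqr_ge (R : realFieldType) (T : finType) (P : pred T) (h : T -> R)
    (t : R) :
  0 <= t -> \sum_(x | P x) h x <= - t * #|P|%:R ->
  t ^+ 2 * #|P|%:R <= \sum_(x | P x) h x ^+ 2.
Proof.
move=> t0 hs.
have : \sum_(x | P x) (- (2%:R * t) * h x - t ^+ 2) <= \sum_(x | P x) h x ^+ 2.
  by apply: ler_sum => x _; have := sqr_ge0 (h x + t); lra.
apply: le_trans; rewrite big_split /= -mulr_sumr sumr_const -mulr_natr; nra.
Qed.

(** * Regularity lemma by energy increment *)

Section Regularity.
Variables (R : realFieldType).

Definition edges (V : finType) (E : rel V) (A B : {set V}) : R :=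
  \sum_(u in setX A B) (E u.1 u.2)%:R.

Definition density (V : finType) (E : rel V) (A B : {set V}) : R :=
  edges E A B / (#|A| * #|B|)%:R.

(* One-sided regularity: no large subpair of [X, Y] is much sparser than
   [X, Y]; this is all that finding triangles requires. *)
Definition sparse_in (V : finType) (E : rel V) (eps : R) (X Y A B : {set V}) :=
  [&& A \subset X, B \subset Y,
      eps * #|X|%:R <= #|A|%:R, eps * #|Y|%:R <= #|B|%:R &
      edges E A B < (density E X Y - eps) * (#|A| * #|B|)%:R].

Definition irregular (V : finType) (E : rel V) (eps : R) (X Y : {set V}) :=
  [exists w : {set V} * {set V}, sparse_in E eps X Y w.1 w.2].

Definition cell (V I : finType) (c : V -> I) (i : I) := [set v | c v == i].

Definition irregular_pairs (V I : finType) (E : rel V) (eps : R) (c : V -> I) :=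
  [set u : V * V | irregular E eps (cell c (c u.1)) (cell c (c u.2))].

Definition pair_color (V I : finType) (c : V -> I) (u : V * V) :=
  (c u.1, c u.2).

Definition adj (V : finType) (E : rel V) (u : V * V) : R := (E u.1 u.2)%:R.

Lemma avg_adj (V I : finType) (E : rel V) (c : V -> I) u :
  avg (pair_color c) (adj E) u = density E (cell c (c u.1)) (cell c (c u.2)).
Proof.
have eqc v : (pair_color c v == pair_color c u)
    = (v \in setX (cell c (c u.1)) (cell c (c u.2))).
  by rewrite !inE /pair_color xpair_eqE.
rewrite /avg /density /edges (eq_bigl _ _ eqc) -cardsX.
by congr (_ / _%:R); apply: eq_card => v; rewrite inE eqc.
Qed.

Section Refine.
Variables (V I : finType) (E : rel V) (eps : R) (c : V -> I).

(** The empty default keeps both components inside their cells for regular pairs too. *)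
Definition witness (i j : I) : {set V} * {set V} :=
  odflt (set0, set0)
    [pick w | sparse_in E eps (cell c i) (cell c j) w.1 w.2].

(* The new colour of [v] records all witnesses containing [v], so that every
   product of witnesses is a union of pairs of refined cells. *)
Definition refine (v : V) : I * {set I} * {set I} :=
  (c v, [set j | v \in (witness (c v) j).1],
        [set j | v \in (witness j (c v)).2]).

Lemma witness_sparse i j : irregular E eps (cell c i) (cell c j) ->
  sparse_in E eps (cell c i) (cell c j) (witness i j).1 (witness i j).2.
Proof.
rewrite /witness; case: pickP => [w //|no] /existsP[w]; by rewrite no.
Qed.

Lemma witness_sub i j :
  (witness i j).1 \subset cell c i /\ (witness i j).2 \subset cell c j.
Proof.
by rewrite /witness; case: pickP => [w /and3P[] //|_]; rewrite !sub0set.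
Qed.

Lemma refine_color v w : refine v = refine w -> c v = c w.
Proof. by case. Qed.

Lemma refine_witness i j u v :
  pair_color refine u = pair_color refine v ->
  (u \in setX (witness i j).1 (witness i j).2)
    = (v \in setX (witness i j).1 (witness i j).2).
Proof.
have [sA sB] := witness_sub i j.
move=> [c1 eA _ c2 _ eB]; rewrite !inE; congr (_ && _).
  have [cu|ncu] := eqVneq (c u.1) i.
    by move/setP/(_ j): eA; rewrite !inE -c1 cu.
  by rewrite !(contraNF (subsetP sA _)) // inE -?c1.
have [cu|ncu] := eqVneq (c u.2) j.
  by move/setP/(_ i): eB; rewrite !inE -c2 cu.
by rewrite !(contraNF (subsetP sB _)) // inE -?c2.
Qed.

(** On an irregular pair of cells the witness rectangle is a union of fibres of the refined
    colouring, so the new average has the same sum there as [adj], and falls short of the old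
    density by at least [eps] on average. Cauchy-Schwarz gives a gain of [eps ^+ 2] per point of the
    rectangle, which fills at least a fraction [eps ^+ 2] of the pair. *)
Lemma energy_refine : 0 <= eps ->
  energy (pair_color c) (adj E) + eps ^+ 4 * #|irregular_pairs E eps c|%:R
    <= energy (pair_color refine) (adj E).
Proof.
move=> e0; rewrite addrC -lerBrDr -energy_pythagoras; last first.
  by move=> x y [c1 _ _ c2 _ _]; rewrite /pair_color c1 c2.
set g' := avg _ _; set g := avg _ _.
rewrite (partition_big (pair_color c) xpredT) //=.
rewrite -sum1_card natr_sum mulr_sumr
  (partition_big (pair_color c) xpredT) //=; apply: ler_sum => -[i j] _.
have pcE u : (pair_color c u == (i, j)) = (u \in setX (cell c i) (cell c j)).
  by rewrite /pair_color xpair_eqE !inE.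
have [irr|reg] := boolP (irregular E eps (cell c i) (cell c j)); last first.
  rewrite big1 => [|u]; first by apply: sumr_ge0 => u _; exact: sqr_ge0.
  by rewrite inE => /andP[+ /eqP[e1 e2]]; rewrite e1 e2 (negPf reg).
rewrite (eq_bigl (mem (setX (cell c i) (cell c j)))); last first.
  move=> u; rewrite pcE /= !inE andbC.
  by have [->|] //= := eqVneq; have [->|] //= := eqVneq; rewrite irr.
have /and5P[sA sB lA lB] := witness_sparse irr.
set A := (witness i j).1 in sA lA *; set B := (witness i j).2 in sB lB *.
move=> dlt; rewrite -mulr_sumr sumr_const cardsX.
have sX : setX A B \subset setX (cell c i) (cell c j) by exact: setXS.
have inX (F : V * V -> R) :
    \sum_(u in setX A B) F u = \sum_u (u \in setX A B)%:R * F u.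
  rewrite big_mkcond; apply: eq_bigr => u _.
  by case: (_ \in _); rewrite ?mul1r ?mul0r.
have gE u : u \in setX A B -> g u = density E (cell c i) (cell c j).
  move=> /(subsetP sX); rewrite /g avg_adj !inE => /andP[/eqP-> /eqP->] //.
have : \sum_(u in setX A B) (g' u - g u) <= - eps * #|setX A B|%:R.
  rewrite sumrB (eq_bigr _ gE) sumr_const inX sum_mul_avg; last first.
    by move=> u v /(refine_witness i j) ->.
  rewrite -inX -/(edges E A B) -mulr_natr cardsX.
  move: dlt; rewrite -/A -/B; nra.
move/(sum_sqr_ge e0) => le1.
apply: (@le_trans _ _ (\sum_(u in setX A B) (g' u - g u) ^+ 2)).
  apply: le_trans le1; rewrite cardsX !natrM.
  have -> : eps ^+ 4 * (#|cell c i|%:R * #|cell c j|%:R) =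
      eps ^+ 2 * ((eps * #|cell c i|%:R) * (eps * #|cell c j|%:R)) by ring.
  apply: ler_wpM2l; first exact: sqr_ge0.
  by apply: ler_pM; rewrite ?mulr_ge0 ?ler0n.
rewrite [leRHS](bigID (mem (setX A B)))/=.
rewrite [in leRHS](eq_bigl (mem (setX A B))); last first.
  by move=> u; rewrite pcE andb_idl //; exact: (subsetP sX).
by rewrite lerDl sumr_ge0 // => u _; exact: sqr_ge0.
Qed.

End Refine.

(** Induction on [m], the number of increments [eps ^+ 5 * (#|V| ^ 2)%:R] for which the energy still
    has room. *)
Lemma regularity_step (eps : R) (m k : nat) : 0 < eps ->
  exists K : nat, forall (V I : finType) (E : rel V) (c : V -> I),
    #|I| = k ->
    (#|V| ^ 2)%:R <= energy (pair_color c) (adj E)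
      + (eps ^+ 5 *+ m) * (#|V| ^ 2)%:R ->
    exists (J : finType) (d : V -> J), (#|J| <= K)%N /\
      #|irregular_pairs E eps d|%:R <= eps * (#|V| ^ 2)%:R.
Proof.
move=> e0.
have gain (V I : finType) (E : rel V) (c : V -> I) :
    eps * (#|V| ^ 2)%:R < #|irregular_pairs E eps c|%:R ->
    energy (pair_color c) (adj E) + eps ^+ 5 * (#|V| ^ 2)%:R
      < energy (pair_color (refine E eps c)) (adj E).
  move=> gt; apply: lt_le_trans (energy_refine E c (ltW e0)).
  by rewrite ltrD2l exprSr -mulrA ltr_pM2l ?exprn_gt0.
elim: m k => [|m IHm] k.
  (* No increment is left: with too many irregular pairs, one more refinement would push the energy
     beyond its maximum [#|V| ^ 2]. *)
  exists k => V I E c cI; rewrite mulr0n mul0r addr0 => le1.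
  exists I, c; split; first by rewrite cI.
  rewrite leNgt; apply/negP => /gain; apply/negP; rewrite -leNgt.
  have f01 u : 0 <= adj E u <= 1 by rewrite /adj; case: (E _ _); rewrite ?ler01 ?lexx.
  have := energy_le (pair_color (refine E eps c)) f01.
  rewrite card_prod mulnn => /le_trans; apply; apply: (le_trans le1).
  by rewrite lerDl mulr_ge0 ?ler0n // exprn_ge0 // ltW.
(* A refined colour is an old colour together with two sets of old colours. *)
have [K IK] := IHm (k * 2 ^ k * 2 ^ k)%N.
exists (maxn k K) => V I E c cI en.
have [le1|/gain gt] := leP (#|irregular_pairs E eps c|%:R) (eps * (#|V| ^ 2)%:R).
  by exists I, c; split; rewrite // leq_max cI leqnn.
have [|| J [d [cJ reg]]] := IK V _ E (refine E eps c).
- have cS : #|{set I}| = (2 ^ k)%N.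
    by rewrite -(cardsT {set I}) -powersetT card_powerset cardsT cI.
  by rewrite !card_prod cS cI.
- apply: le_trans en _; move: gt; rewrite mulrS mulrDl; lra.
- by exists J, d; rewrite leq_max cJ orbT.
Qed.

(** The iteration starts from a single colour; its energy is nonnegative, and [m] increments cover
    the maximum. *)
Lemma regularity (eps : R) (m : nat) : 0 < eps -> 1 <= eps ^+ 5 *+ m ->
  exists K : nat, forall (V : finType) (E : rel V),
    exists (I : finType) (c : V -> I), (#|I| <= K)%N /\
      #|irregular_pairs E eps c|%:R <= eps * (#|V| ^ 2)%:R.
Proof.
move=> e0 em; have [K HK] := regularity_step m 1 e0.
exists K => V E; apply: (HK V unit E (fun=> tt)); first by rewrite card_unit.
have en0 : 0 <= energy (pair_color (fun _ : V => tt)) (adj E).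
  by apply: sumr_ge0 => u _; exact: sqr_ge0.
by rewrite -[leLHS]add0r lerD // ler_peMl // ler0n.
Qed.

End Regularity.

(** * Triangles in regular triples, and triangle removal *)

Section TriangleCount.
Variables (R : realFieldType) (V : finType) (E : rel V).

Definition nbhd (X : {set V}) (v : V) := [set w in X | E v w].

Lemma edgesE (A B : {set V}) :
  edges R E A B = \sum_(x in A) #|nbhd B x|%:R.
Proof.
rewrite /edges (eq_bigl (fun u : V * V => (u.1 \in A) && (u.2 \in B))); last first.
  by move=> u; rewrite inE.
rewrite -(pair_big (mem A) (mem B) (fun x y => (E x y)%:R)) /=.
apply: eq_bigr => x _; rewrite -sum1_card natr_sum big_mkcond [RHS]big_mkcond.
by apply: eq_bigr => y _; rewrite inE; case: (y \in B); case: (E x y).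
Qed.

(** Otherwise the low-degree vertices, paired with all of [Y], would form a large subpair of density
    below [eps]. *)
Lemma low_degree_card (eps : R) (X Y : {set V}) :
  0 < eps <= 1 -> (0 < #|X|)%N -> ~~ irregular E eps X Y ->
  2%:R * eps <= density R E X Y ->
  #|[set x in X | #|nbhd Y x|%:R < eps * #|Y|%:R]|%:R < eps * #|X|%:R.
Proof.
move=> /andP[e0 e1] X0 reg dense; set A := [set x in X | _].
rewrite ltNge; apply/negP => leA.
move/negP: reg; apply; apply/existsP; exists (A, Y) => /=.
have A0 : (0 < #|A|)%N.
  by rewrite -(ltr0n R); apply: lt_le_trans leA; rewrite mulr_gt0 ?ltr0n.
apply/and5P; split => //.
- by apply/subsetP => x; rewrite inE => /andP[].
- by rewrite ler_piMl // ler0n.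
apply: (@lt_le_trans _ _ (eps * (#|A| * #|Y|)%:R)); last first.
  by apply: ler_wpM2r; rewrite ?ler0n //; lra.
have [a aA] := card_gt0P A0.
rewrite edgesE natrM mulrCA mulr_natl -sumr_const.
apply: ltr_sum => [|x]; last by rewrite inE => /andP[].
by apply/hasP; exists a; rewrite ?mem_index_enum.
Qed.

Lemma exists_high_degree (eps : R) (X Y Z : {set V}) :
  0 < eps -> 2%:R * eps <= 1 -> (0 < #|X|)%N ->
  ~~ irregular E eps X Y -> 2%:R * eps <= density R E X Y ->
  ~~ irregular E eps X Z -> 2%:R * eps <= density R E X Z ->
  exists x, [/\ x \in X, eps * #|Y|%:R <= #|nbhd Y x|%:R
                & eps * #|Z|%:R <= #|nbhd Z x|%:R].
Proof.
move=> e0 e1 X0 rY dY rZ dZ.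
have e01 : 0 < eps <= 1 by apply/andP; split=> //; lra.
have := low_degree_card e01 X0 rY dY; have := low_degree_card e01 X0 rZ dZ.
set AZ := [set x in X | _]; set AY := [set x in X | _] => cZ cY.
have : ~~ (X \subset AY :|: AZ).
  apply/negP => /subset_leq_card/leq_trans/(_ (leq_card_setU _ _)).
  rewrite -(ler_nat R) natrD; have : 0 < #|X|%:R :> R by rewrite ltr0n.
  nra.
case/subsetPn => x xX; rewrite !inE xX /= negb_or -!leNgt => /andP[].
by exists x.
Qed.

(** The neighbourhoods of a high-degree vertex fill a fraction [eps] of [Y] and of [Z]; regularity
    of [Y], [Z] then forces density at least [eps] between them. *)
Lemma regular_triangles (eps : R) (X Y Z : {set V}) :
  0 < eps -> 2%:R * eps <= 1 -> (0 < #|X|)%N ->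
  ~~ irregular E eps X Y -> 2%:R * eps <= density R E X Y ->
  ~~ irregular E eps X Z -> 2%:R * eps <= density R E X Z ->
  ~~ irregular E eps Y Z -> 2%:R * eps <= density R E Y Z ->
  exists2 x, x \in X &
    eps ^+ 3 * (#|Y|%:R * #|Z|%:R) <= edges R E (nbhd Y x) (nbhd Z x).
Proof.
move=> e0 e1 X0 rXY dXY rXZ dXZ rYZ dYZ.
have [x [xX nY nZ]] := exists_high_degree e0 e1 X0 rXY dXY rXZ dXZ.
exists x => //; rewrite leNgt; apply: contra rYZ => lt.
apply/existsP; exists (nbhd Y x, nbhd Z x); apply/and5P; split=> //=.
- by apply/subsetP => y; rewrite inE => /andP[].
- by apply/subsetP => y; rewrite inE => /andP[].
apply: (lt_le_trans lt).
have -> : eps ^+ 3 * (#|Y|%:R * #|Z|%:R) =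
  eps * ((eps * #|Y|%:R) * (eps * #|Z|%:R)) by ring.
apply: ler_pM; rewrite ?mulr_ge0 ?ler0n ?(ltW e0) //; first by lra.
by rewrite natrM; apply: ler_pM; rewrite ?mulr_ge0 ?ler0n ?(ltW e0).
Qed.

(** Sparseness depends only on the pair of colours, so averaging turns the count into a sum of
    densities below [d]. *)
Lemma card_sparse_edges (I : finType) (c : V -> I) (d : R) : 0 <= d ->
  #|[set u : V * V | E u.1 u.2 &
      density R E (cell c (c u.1)) (cell c (c u.2)) < d]|%:R
    <= d * (#|V| ^ 2)%:R.
Proof.
move=> d0; set sp := fun u : V * V =>
  density R E (cell c (c u.1)) (cell c (c u.2)) < d.
rewrite -sum1_card natr_sum big_mkcond.
rewrite (eq_bigr (fun u => (sp u)%:R * adj R E u)); last first.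
  move=> u _; rewrite inE -/(sp u) /adj.
  by case: (E _ _); case: (sp u); rewrite /= ?mulr1 ?mulr0.
rewrite -(@sum_mul_avg _ _ _ (pair_color c)); last first.
  by move=> u v [e1 e2]; rewrite /sp e1 e2.
rewrite -mulnn -card_prod -sum1_card natr_sum mulr_sumr.
apply: ler_sum => u _; rewrite avg_adj mulr1.
by rewrite /sp; case: ltP => [/ltW|_]; rewrite ?mul1r ?mul0r.
Qed.

Lemma card_small_cells (I : finType) (c : V -> I) (s : R) : 0 <= s ->
  #|[set v | #|cell c (c v)|%:R < s]|%:R <= #|I|%:R * s.
Proof.
move=> s0; rewrite -sum1_card natr_sum (partition_big c xpredT) //=.
rewrite mulr_natl -sumr_const; apply: ler_sum => i _.
have [lt|ge] := ltP (#|cell c i|%:R) s.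
  apply: le_trans (ltW lt); rewrite -natr_sum sum1_card ler_nat.
  by apply/subset_leq_card/subsetP => v; rewrite !inE => /andP[].
rewrite big1 // => v; rewrite inE => /andP[lt /eqP cv].
by move: lt; rewrite cv ltNge ge.
Qed.

End TriangleCount.

(* No triangle can run through three dense regular pairs of large cells: some
   vertex of the first cell would then lie in more than [m * #|V|] triangles. *)
Lemma triangle_removal (R : archiRealFieldType) (eps : R) (m : nat) :
  0 < eps ->
  exists N : nat, forall (V : finType) (E : rel V), (N <= #|V|)%N ->
    (forall x y, E x y -> #|[set z | E x z & E y z]| <= m)%N ->
    exists2 B : {set V * V}, #|B|%:R <= eps * (#|V| ^ 2)%:R &
      forall x y z, E x y -> E x z -> E y z ->
        [|| (x, y) \in B, (x, z) \in B | (y, z) \in B].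
Proof.
(* Five shares of [e] are spent: one on irregular pairs, one on each endpoint in a small cell, two
   on sparse pairs. The bound [1 / 2] serves the choice of a high-degree vertex. *)
move=> eps0; pose e : R := Num.min (eps / 5%:R) (1 / 2%:R).
have e0 : 0 < e by rewrite lt_min !divr_gt0.
have e5 : 5%:R * e <= eps by rewrite -ler_pdivlMl ?ge_min ?[_^-1 * _]mulrC ?lexx.
have e2 : 2%:R * e <= 1.
  by rewrite -ler_pdivlMl // ge_min [X in _ || (_ <= X)]mulrC lexx orbT.
have e50 : 0 < e ^+ 5 by rewrite exprn_gt0.
have [K HK] : exists K : nat, forall (V : finType) (E : rel V),
    exists (I : finType) (c : V -> I), (#|I| <= K)%N /\
      #|irregular_pairs E e c|%:R <= e * (#|V| ^ 2)%:R.
  apply: (@regularity _ _ (Num.bound (e ^+ 5)^-1)) => //.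
  rewrite -mulr_natr mulrC -ler_pdivrMr // mul1r ltW //.
  by rewrite archi_boundP // invr_ge0 ltW.
(* With at most [K] cells, those smaller than [t * #|V|] hold at most [e * #|V|] vertices in
   total. *)
pose t : R := e / K.+1%:R; have t0 : 0 < t by rewrite divr_gt0.
pose a := e ^+ 3 * t ^+ 2; have a0 : 0 < a by rewrite mulr_gt0 ?exprn_gt0.
exists (Num.bound (m%:R / a)).+1 => V E leN tri.
have N0 : 0 < #|V|%:R :> R by rewrite ltr0n; case: #|V| leN.
have Na : m%:R < a * #|V|%:R.
  rewrite mulrC -ltr_pdivrMr //.
  apply: lt_le_trans (archi_boundP _) _; first by rewrite divr_ge0 ?ler0n ?(ltW a0).
  by rewrite ler_nat ltnW.
have [I [c [cI reg]]] := HK V E.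
pose sm := [set v | #|cell c (c v)|%:R < t * #|V|%:R].
have csm : #|sm|%:R <= e * #|V|%:R.
  apply: le_trans (card_small_cells c _) _; first by rewrite mulr_ge0 ?ltW.
  have : #|I|%:R <= K.+1%:R :> R by rewrite ler_nat ltnW.
  move=> /(ler_wpM2r (ltW (mulr_gt0 t0 N0)))/le_trans; apply.
  by rewrite mulrA [_ * t]mulrC /t divfK ?pnatr_eq0.
pose sp := [set u : V * V | E u.1 u.2 &
      density R E (cell c (c u.1)) (cell c (c u.2)) < 2%:R * e].
have csp : #|sp|%:R <= (2%:R * e) * (#|V| ^ 2)%:R.
  by apply: card_sparse_edges; rewrite mulr_ge0 ?ltW.
exists (irregular_pairs E e c :|: setX sm setT :|: setX setT sm :|: sp).
  apply: (@le_trans _ _ (#|irregular_pairs E e c| + #|sm| * #|V| +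
      #|V| * #|sm| + #|sp|)%:R).
    rewrite ler_nat.
    have c1 : #|setX sm [set: V]| = (#|sm| * #|V|)%N by rewrite cardsX cardsT.
    have c2 : #|setX [set: V] sm| = (#|V| * #|sm|)%N by rewrite cardsX cardsT.
    rewrite -c1 -c2; do 3! apply: leq_trans (leq_card_setU _ _) (leq_add _ (leqnn _)).
    done.
  rewrite !natrD !natrM; move: reg csm csp; rewrite -mulnn natrM; nra.
move=> x y z Exy Exz Eyz; apply/negPn/negP; rewrite !negb_or => /and3P[].
rewrite !inE /= !andbT Exy Exz Eyz /= !negb_or -!leNgt.
move=> /andP[/andP[/andP[rxy sx] sy] dxy] /andP[/andP[/andP[rxz _] sz] dxz].
move=> /andP[/andP[/andP[ryz _] _] dyz].
have X0 : (0 < #|cell c (c x)|)%N by apply/card_gt0P; exists x; rewrite inE.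
have [v vX] := regular_triangles e0 e2 X0 rxy dxy rxz dxz ryz dyz.
apply/negP; rewrite -ltNge edgesE.
(* Each neighbour [w] of [v] contributes at most [m], the bound on triangles through the edge [v],
   [w]. *)
apply: (@le_lt_trans _ _ (m%:R * #|V|%:R)).
  rewrite mulr_natr -sumr_const [leRHS](bigID (mem (nbhd E (cell c (c y)) v))) /=.
  rewrite -[leLHS]addr0; apply: lerD; last by rewrite sumr_ge0.
  apply: ler_sum => w; rewrite inE => /andP[_ Evw].
  rewrite ler_nat; apply: leq_trans (tri v w Evw).
  by apply/subset_leq_card/subsetP => r; rewrite !inE => /andP[/andP[_ ->] ->].
apply: (@lt_le_trans _ _ (a * #|V|%:R * #|V|%:R)); first by rewrite ltr_pM2r.
have -> : a * #|V|%:R * #|V|%:R = e ^+ 3 * (t * #|V|%:R * (t * #|V|%:R)).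
  by rewrite /a; ring.
apply: ler_wpM2l; first by rewrite exprn_ge0 ?ltW.
by apply: ler_pM => //; rewrite mulr_ge0 ?ltW.
Qed.

(** * Subspaces spanned by two vectors *)

Section Planes.
Variables (F : fieldType) (vT : vectType F).
Implicit Types (x y z : vT) (W : {vspace vT}).

Definition plane x y : {vspace vT} := (<[x]> + <[y]>)%VS.

Lemma plane_memE x y W : (plane x y <= W)%VS = (x \in W) && (y \in W).
Proof. by rewrite subv_add !memvE. Qed.

Lemma mem_planel x y : x \in plane x y.
Proof. by have := subvv (plane x y); rewrite plane_memE => /andP[]. Qed.

Lemma mem_planer x y : y \in plane x y.
Proof. by have := subvv (plane x y); rewrite plane_memE => /andP[]. Qed.

Lemma plane_addr x y : plane x (x + y) = plane x y.
Proof.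
apply/subv_anti; rewrite !plane_memE !mem_planel memvD ?mem_planel ?mem_planer //=.
have := memvB (mem_planer x (x + y)) (mem_planel x (x + y)).
by rewrite addrC addKr.
Qed.

Lemma planeC x y : plane x y = plane y x.
Proof. exact: addvC. Qed.

Lemma dim2_plane W : \dim W = 2 -> exists x y, W = plane x y.
Proof.
move=> dW; have := span_basis (vbasisP W).
have : size (vbasis W) = 2 by rewrite size_tuple.
case: (tval _) => [|x [|y []]] //= _ <-; exists x, y.
by rewrite span_cons span_seq1.
Qed.

Lemma dim_plane_add x y z : (\dim (plane x y + <[z]>) <= 3)%N.
Proof.
have d1 v : (\dim <[v]> <= 1)%N by rewrite dim_vline leq_b1.
have dA (U W : {vspace vT}) : (\dim (U + W) <= \dim U + \dim W)%N.
  exact: dimv_add_leqif.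
have dxy : (\dim (plane x y) <= 1 + 1)%N.
  by apply: leq_trans (dA <[x]>%VS <[y]>%VS) _; apply: leq_add.
by apply: leq_trans (dA _ _) _; apply: (leq_add dxy).
Qed.

End Planes.

(** * The graph of a code and its triangles *)

Section CodeGraph.
Variables (F : finFieldType) (n : nat) (C : seq {vspace 'rV[F]_n}).
Hypothesis codeC : covering_grassmannian_code 2 2 3 C.

Definition code_graph : rel 'rV[F]_n := fun x y => plane x y \in C.

Lemma code_triangle x y z :
  code_graph x y -> code_graph x z -> code_graph y z -> z \in plane x y.
Proof.
case: codeC => _ dimC spanC Cxy Cxz Cyz.
have [uS|] := boolP (uniq [:: plane x y; plane x z; plane y z]).
  have sS : {subset [:: plane x y; plane x z; plane y z] <= C}.
    by move=> W; rewrite !inE => /or3P[] /eqP->.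
  have := spanC _ uS erefl sS; rewrite leqNgt => /negP[].
  have d4 : (\dim (plane x y + <[z]>)%VS < 2 + 2)%N.
    by rewrite ltnS dim_plane_add.
  apply: leq_ltn_trans d4; apply: dimvS.
  have sxy := addvSl (plane x y) <[z]>; have sz := addvSr (plane x y) <[z]>.
  have zI := subvP sz _ (memv_line z).
  have [xI yI] := (subvP sxy _ (mem_planel x y), subvP sxy _ (mem_planer x y)).
  by rewrite !big_cons big_nil addv0 !subv_add -!memvE xI yI zI.
rewrite /= !inE andbT negb_and !negbK => /orP[/orP[]|] /eqP eqW.
- by rewrite eqW mem_planer.
- by rewrite eqW mem_planer.
(* Here [plane x z = plane y z] contains both [x] and [y], and all codewords have dimension 2. *)
suff -> : plane x y = plane x z by exact: mem_planer.
apply/eqP; rewrite eqEdim !dimC // leqnn andbT plane_memE mem_planel.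
by rewrite eqW mem_planel.
Qed.

Lemma card_code_triangles x y : code_graph x y ->
  (#|[set z | code_graph x z & code_graph y z]| <= #|F| ^ 2)%N.
Proof.
move=> Cxy; rewrite -mulnn -card_prod -cardsT.
apply: leq_trans (leq_imset_card (fun p : F * F => p.1 *: x + p.2 *: y) _).
apply/subset_leq_card/subsetP => z; rewrite inE => /andP[Cxz Cyz].
have /memv_addP[_ /vlineP[a ->] [_ /vlineP[b ->] ->]] := code_triangle Cxy Cxz Cyz.
by apply/imsetP; exists (a, b).
Qed.

(** The three edges of the triangle [x], [y], [x + y] span the same codeword, so whichever lies in
    [B] recovers it. *)
Lemma code_size_le (B : {set 'rV[F]_n * 'rV[F]_n}) :
  (forall x y z, code_graph x y -> code_graph x z -> code_graph y z ->
     [|| (x, y) \in B, (x, z) \in B | (y, z) \in B]) ->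
  (size C <= #|B|)%N.
Proof.
case: codeC => uC dimC _ hB; rewrite cardE -(size_map (fun p => plane p.1 p.2)).
apply: uniq_leq_size => // W WC; have [x [y eW]] := dim2_plane (dimC _ WC).
have e2 : plane x (x + y) = W by rewrite plane_addr.
have e3 : plane y (x + y) = W by rewrite addrC plane_addr planeC.
have /or3P[] : [|| (x, y) \in B, (x, x + y) \in B | (y, x + y) \in B].
- by apply: hB; rewrite /code_graph -?eW ?e2 ?e3.
- by move=> hp; apply/mapP; exists (x, y); rewrite ?mem_enum.
- by move=> hp; apply/mapP; exists (x, x + y); rewrite ?mem_enum.
- by move=> hp; apply/mapP; exists (y, x + y); rewrite ?mem_enum.
Qed.

End CodeGraph.

Local Close Scope ring_scope.

(* For every finite field F (q = #|F| ranges over all prime powers),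
   B_q(n,2,2;3) = o(q^(2n)): for every eps > 0 there is N such that for all
   n >= N every 3-(n,2,2)_q^c code has at most eps * q^(2n) codewords. *)
Theorem mainTheorem6 (F : finFieldType) :
  forall eps : rat, (0 < eps)%R ->
  exists N : nat, forall n : nat, (N <= n)%N ->
  forall C : seq {vspace 'rV[F]_n},
    covering_grassmannian_code 2 2 3 C ->
    ((size C)%:R <= eps * (#|F| ^ (2 * n))%:R :> rat)%R.
Proof.
move=> eps eps0; have [N HN] := triangle_removal (#|F| ^ 2) eps0.
exists N => n leNn C codeC.
have cV : #|{: 'rV[F]_n}| = #|F| ^ n by rewrite card_mx mul1n.
have leV : N <= #|{: 'rV[F]_n}|.
  by rewrite cV (leq_trans leNn) // ltnW // ltn_expl // finRing_gt1.
have [B cB hB] := HN _ (code_graph C) leV (card_code_triangles codeC).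
rewrite mulnC expnM -cV; apply: le_trans cB.
by rewrite ler_nat (code_size_le codeC hB).
Qed.
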